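(* Let $t_0<t_1$ be real numbers, let $f\in C([t_0,t_1],\mathbb{R})$, $0<\alpha\le 1$ and $\beta>0$. Consider the condition $$\int_{t_0}^{t_1}(t_1-t)^{\beta-1}f(t)\,({}^{c}D_{t_0+}^{\alpha}h)(t)\,dt=0\qquad\text{for all } h\in C_0^{\alpha}([t_0,t_1],\mathbb{R}).\tag{$*$}$$ For $( * )$ to hold it is necessary and sufficient that: 1) $(t_1-t)^{\beta-\alpha}f(t)=0$ on $[t_0,t_1]$, if $\beta>\alpha>0$; 2) $f(t)=\frac{k}{\Gamma(\alpha)}(t_1-t)^{\alpha-\beta}$ on $[t_0,t_1]$ for some constant $k\neq 0$, if $0<\beta\le\alpha\le 1$.
   Context: For $\alpha>0$ the left-sided Riemann–Liouville fractional integral is $(I_{t_0+}^{\alpha}\varphi)(t)=\frac{1}{\Gamma(\alpha)}\int_{t_0}^{t}(t-\tau)^{\alpha-1}\varphi(\tau)\,d\tau$, and $I_{t_0+}^{0}\varphi=\varphi$. For $0<\alpha\le1$ the left-sided Caputo derivative of $\varphi$ is $({}^{c}D_{t_0+}^{\alpha}\varphi)(t)=\frac{d}{dt}\big(I_{t_0+}^{1-\alpha}(\varphi(\cdot)-\varphi(t_0))\big)(t)$. $C^{\alpha}([t_0,t_1],\mathbb{R})$ is the set of functions $\varphi:[t_0,t_1]\to\mathbb{R}$ of the form $\varphi(t)=\varphi(t_0)+(I_{t_0+}^{\alpha}\psi)(t)$, $t\in[t_0,t_1]$, with $\psi\in C([t_0,t_1],\mathbb{R})$; for such $\varphi$ one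 has ${}^{c}D_{t_0+}^{\alpha}\varphi=\psi$ on $[t_0,t_1]$. $C_0^{\alpha}([t_0,t_1],\mathbb{R})=\{\varphi\in C^{\alpha}([t_0,t_1],\mathbb{R}) : \varphi(t_0)=\varphi(t_1)=0\}$. Convention: $0^0=1$.
   Formalization: In case 2 the formal theorem adds the alternative ''f = 0 on [t0,t1]'' (i.e. k = 0), because f = 0 satisfies ( * ) but is not of the stated form with k ≠ 0; for all other f the equivalence is as stated. *)

(* Defs.v *)
(* A function on [t0, t1] is represented by a total function R -> R; at points of
   [t0, t1], no definition below depends on its values outside [t0, t1]. *)
From HB Require Import structures.
From mathcomp Require Import all_boot all_order all_algebra.
From mathcomp Require Import all_classical all_reals all_analysis.

Set Implicit Arguments.
Unset Strict Implicit.
Unset Printing Implicit Defensive.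

Import Order.TTheory GRing.Theory Num.Theory.
Import numFieldNormedType.Exports.

Local Open Scope classical_set_scope.
Local Open Scope ring_scope.

Definition Gamma (R : realType) (a : R) : R :=
  \int[lebesgue_measure]_(x in `[0, +oo[) (x `^ (a - 1) * expR (- x)).

(* `powR` satisfies 0 `^ 0 = 1; it also sets 0 `^ x = 0 for x < 0, which only
   affects the integrands on a null set. *)
Definition RL_integral (R : realType) (a t0 : R) (phi : R -> R) (t : R) : R :=
  if a == 0 then phi t
  else (Gamma a)^-1 *
       \int[lebesgue_measure]_(tau in `[t0, t]) ((t - tau) `^ (a - 1) * phi tau).

(* Two-sided at interior points of `[t0, t1], one-sided at the endpoints. *)
Definition derivative_on (R : realType) (t0 t1 : R) (F : R -> R) (t : R) : R :=
  lim ((fun s => (F s - F t) / (s - t)) @ within `[t0, t1]%classic t^').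

Definition caputo (R : realType) (t0 t1 a : R) (phi : R -> R) : R -> R :=
  derivative_on t0 t1 (RL_integral (1 - a) t0 (fun s => phi s - phi t0)).

Definition Calpha (R : realType) (t0 t1 a : R) (phi : R -> R) : Prop :=
  exists psi : R -> R, {within `[t0, t1], continuous psi} /\
    forall t, t \in `[t0, t1] -> phi t = phi t0 + RL_integral a t0 psi t.

Definition Calpha0 (R : realType) (t0 t1 a : R) (phi : R -> R) : Prop :=
  [/\ Calpha t0 t1 a phi, phi t0 = 0 & phi t1 = 0].

Definition variational_condition (R : realType) (t0 t1 a b : R) (f : R -> R) : Prop :=
  forall h : R -> R, Calpha0 t0 t1 a h ->
    \int[lebesgue_measure]_(t in `[t0, t1])
      ((t1 - t) `^ (b - 1) * f t * caputo t0 t1 a h t) = 0.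

(* Main.v *)
(** Writing [h = I^alpha psi], the semigroup law [I^(1-alpha) I^alpha = I^1] shows
    that the Caputo derivative of [h] is [psi] on the open interval, so that the
    variational condition says: [(t1 - t)^(beta-1) f] is orthogonal to every
    continuous [psi] that is orthogonal to [(t1 - t)^(alpha-1)].  As in the lemma of
    du Bois-Reymond, this forces [(t1 - t)^(beta-alpha) f] to be a constant [k] on
    the open interval, and the dichotomy follows by continuity at [t1].  The semigroup
    law rests on Fubini's theorem and on
    [\int_0^s (s - x)^(-alpha) x^(alpha-1) dx = Gamma (1 - alpha) * Gamma alpha]. *)

(* Two singularities shape the proof. Power kernels of order below 1 blow up at the origin. They are
   replaced by a kernel cut off at 0, so that the bounds of integration are carried by supports, and
   translation, scaling and Tonelli's theorem all act on the whole line. The exponents of the beta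
   integral add up to -1, which makes it independent of [s]; averaging it against the density of
   mass 1 [expR (- s)] then splits it into a product of two Gamma integrals. The other singularity
   is at [t1]. The classical test function [g - k], with [g = (t1 - t)^(beta - alpha) f], may be
   unbounded there when [beta < alpha], whereas only continuous test functions are available; a
   power of [t1 - t] is inserted to restore continuity. Moreover, the algebra of powers and the
   formula for the Caputo derivative are established on the open interval only, so every passage to
   an integral over [[t0, t1]] discards the endpoints, with measurability of the integrands as side
   condition. *)
Require Import Defs.
From HB Require Import structures.
From mathcomp Require Import all_boot all_order all_algebra.
From mathcomp Require Import all_classical all_reals all_analysis.
From mathcomp Require Import ring lra.
From mathcomp Require Import measurable_realfun.
Import Order.TTheory GRing.Theory Num.Theory.
Import numFieldNormedType.Exports.
Local Open Scope classical_set_scope.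
Local Open Scope ring_scope.

(** * Affine changes of variables *)

Section affine.
Context {R : realType}.
Local Notation mu := (@lebesgue_measure R).

Let affine (a b : R) : measurableTypeR R -> measurableTypeR R := fun x => a * x + b.

Let measurable_affine a b : measurable_fun setT (affine a b).
Proof.
exact: measurable_funD.
Qed.

HB.instance Definition _ a b :=
  isMeasurableFun.Build _ _ _ _ (affine a b) (measurable_affine a b).

Let preimage_affine (a b u v : R) (a0 : a != 0) :
  (mu (affine a b @^-1` `]u, v]) = (`|a|^-1)%:E * mu `]u, v]%classic)%E.
Proof.
have -> : affine a b @^-1` `]u, v] =
    if 0 < a then `](u - b) / a, (v - b) / a]%classic
    else `[(v - b) / a, (u - b) / a[%classic.
  apply/seteqP; split => x /=; rewrite /affine /=;
    case: ltgtP a0 => // a0 _ /=; rewrite !in_itv/=.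
  - by rewrite ltr_pdivrMr// ler_pdivlMr// (mulrC x) ltrBlDr lerBrDr => /andP[-> ->].
  - by rewrite ltr_ndivlMr// ler_ndivrMr// (mulrC x) ltrBlDr lerBrDr => /andP[-> ->].
  - by rewrite ltr_pdivrMr// ler_pdivlMr// (mulrC x) ltrBlDr lerBrDr => /andP[-> ->].
  - by rewrite ltr_ndivlMr// ler_ndivrMr// (mulrC x) ltrBlDr lerBrDr => /andP[-> ->].
case: ltgtP a0 => // a0 _; rewrite !lebesgue_measure_itv/= !lte_fin.
- rewrite ltr_pdivrMr// divfK ?gt_eqF// ltrD2r; case: ifPn => _; rewrite ?mule0//.
  by rewrite gtr0_norm// -!EFinB -EFinM; congr EFin; field; rewrite gt_eqF.
- rewrite ltr_ndivrMr// divfK ?lt_eqF// ltrD2r; case: ifPn => _; rewrite ?mule0//.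
  by rewrite ltr0_norm// -!EFinB -EFinM; congr EFin; field; rewrite lt_eqF.
Qed.

(** Lebesgue measure is determined by its values on the intervals []u, v]], and [|a|] times its
    pushforward under [x |-> a * x + b] has the same values there. *)
Lemma ge0_integral_affine (a b : R) (f : R -> \bar R) : a != 0 ->
  measurable_fun setT f -> (forall x, 0 <= f x)%E ->
  (\int[mu]_x f (a * x + b)%R = (`|a|^-1)%:E * \int[mu]_x f x)%E.
Proof.
move=> a0 mf f0.
have na0 : 0 <= `|a| by [].
pose k : {nonneg R} := NngNum na0.
transitivity (\int[pushforward mu (affine a b)]_x f x)%E.
  by rewrite (ge0_integral_pushforward (measurable_affine a b)).
have E A : measurable A -> mu A = mscale k (pushforward mu (affine a b)) A.
  move=> mA.
  apply: lebesgue_measure_unique => // _ [[u v]] _ <-.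
  transitivity (`|a|%:E * mu (affine a b @^-1` `]u, v]))%E; last by [].
  rewrite preimage_affine// muleA -EFinM mulfV ?normr_eq0// mul1e//.
rewrite [in RHS](@eq_measure_integral _ _ _ _
  (mscale k (pushforward mu (affine a b)))); last first.
  by move=> A mA _; exact: E.
rewrite ge0_integral_mscale// muleA -EFinM mulVf ?normr_eq0// mul1e//.
Qed.
End affine.
Section affine_special.
Context {R : realType}.
Local Notation mu := (@lebesgue_measure R).
Local Open Scope ereal_scope.

Lemma ge0_integral_scale (s : R) (f : R -> \bar R) : (0 < s)%R ->
  measurable_fun setT f -> (forall x, 0 <= f x) ->
  \int[mu]_x f (s * x)%R = (s^-1)%:E * \int[mu]_x f x.
Proof.
move=> s0 mf f0.
rewrite -[s in RHS](gtr0_norm s0) -(ge0_integral_affine s 0%R)//.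
  by apply: eq_integral => x _; rewrite addr0.
by rewrite gt_eqF.
Qed.

Lemma ge0_integral_shift (c : R) (f : R -> \bar R) :
  measurable_fun setT f -> (forall x, 0 <= f x) ->
  \int[mu]_x f (x - c)%R = \int[mu]_x f x.
Proof.
move=> mf f0; have := ge0_integral_affine 1 (- c)%R f (oner_neq0 _) mf f0.
rewrite normr1 invr1 => E.
rewrite -[RHS]mul1e -E.
by apply: eq_integral => x _; rewrite mul1r.
Qed.

Lemma ge0_integral_reflect (c : R) (f : R -> \bar R) :
  measurable_fun setT f -> (forall x, 0 <= f x) ->
  \int[mu]_x f (c - x)%R = \int[mu]_x f x.
Proof.
move=> mf f0; have N10 : (-1 : R)%R != 0%R by rewrite oppr_eq0 oner_neq0.
have := ge0_integral_affine (-1)%R c f N10 mf f0.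
rewrite normrN1 invr1 => E.
rewrite -[RHS]mul1e -E.
by apply: eq_integral => x _; rewrite mulN1r addrC.
Qed.
End affine_special.

(** Infinite values are allowed, so that convolution integrals can be compared before they are known
    to be finite. *)
Lemma mule_fin_inj (R : realType) (s : R) (x y : \bar R) : s != 0 ->
  (s%:E * x = s%:E * y)%E -> x = y.
Proof.
move=> s0 /(congr1 (fun z => ((s^-1)%:E * z)%E)).
by rewrite !muleA -EFinM mulVf// !mul1e.
Qed.

(** * The Riemann-Liouville kernel *)

Section kernel.
Context {R : realType}.
Local Notation mu := (@lebesgue_measure R).

(* Unlike [x `^ (a - 1)], this vanishes for [x < 0], and at [0] even when [a = 1]. *)
Definition RL_kernel (a x : R) : R := if 0 < x then x `^ (a - 1) else 0.

Lemma RL_kernel_ge0 a x : 0 <= RL_kernel a x.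
Proof. by rewrite /RL_kernel; case: ifPn => // _; exact: powR_ge0. Qed.

Lemma measurable_RL_kernel a : measurable_fun setT (RL_kernel a).
Proof.
apply: measurable_fun_ifT.
- exact: measurable_fun_ltr.
- exact: measurable_powR.
- exact: measurable_cst.
Qed.

(** The primitive is [a^-1 * x ^ a]; with [0 < u] the interval avoids the singularity at 0 and the
    fundamental theorem applies. *)
Lemma integral_RL_kernel_itv (a u v : R) : 0 < a -> 0 < u -> u <= v ->
  (\int[mu]_(x in `[u, v]) (RL_kernel a x)%:E = (a^-1 * v `^ a - a^-1 * u `^ a)%:E)%E.
Proof.
move=> a0 u0; rewrite le_eqVlt => /predU1P[<-|uv].
  by rewrite set_itv1 integral_set1 subrr.
have c x b : 0 < x -> {for x, continuous (fun x => x `^ b)}.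
  move=> x0; apply: differentiable_continuous; apply/derivable1_diffP.
  by have [] := is_derive1_powR b x0.
have c' x : 0 < x -> {for x, continuous (fun x => a^-1 * x `^ a)}.
  by move=> x0; apply: continuousM; [exact: cst_continuous|exact: c].
have v0 := lt_trans u0 uv.
under eq_integral => x.
  rewrite inE/= in_itv/= /RL_kernel => /andP[/(lt_le_trans u0)-> _]; over.
rewrite (@continuous_FTC2 _ _ (fun x => a^-1 * x `^ a))//.
- apply/continuous_within_itvP => //; split.
  + move=> x; rewrite in_itv/= => /andP[/(lt_trans u0) ? _]; exact: c.
  + by apply: cvg_at_right_filter; exact: c.
  + by apply: cvg_at_left_filter; exact: c.
- split.
  + move=> x; rewrite in_itv/= => /andP[ux _]; apply: derivableM => //.
    by have [] := is_derive1_powR a (lt_trans u0 ux).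
  + by apply: cvg_at_right_filter; exact: c'.
  + by apply: cvg_at_left_filter; exact: c'.
- move=> x; rewrite in_itv/= => /andP[/(lt_trans u0) x0 _].
  rewrite derive1E; have := is_derive1_powR a x0 => dx.
  rewrite deriveZ//= derive_val /GRing.scale/= mulrA mulVf ?mul1r// gt_eqF//.
Qed.

(** Monotone convergence along the intervals [[c / n.+1, c]], on which the integrals are all at most
    [a^-1 * c ^ a]. *)
Lemma integral_RL_kernel_lty (a c : R) : 0 < a -> 0 < c ->
  (\int[mu]_(x in `]0%R, c]) (RL_kernel a x)%:E < +oo)%E.
Proof.
move=> a0 c0.
pose F n : set R := `[c / n.+1%:R, c]%classic.
have mF n : measurable (F n) by exact: measurable_itv.
have mk D : measurable_fun D (EFin \o RL_kernel a).
  by apply/measurable_EFinP; apply: measurable_funTS; exact: measurable_RL_kernel.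
have FE : \bigcup_n F n = `]0, c]%classic.
  apply/seteqP; split => x.
    move=> [n _]; rewrite /F/= !in_itv/= => /andP[nx ->]; rewrite andbT.
    by apply: lt_le_trans nx; rewrite divr_gt0.
  rewrite /= in_itv/= => /andP[x0 xc].
  (* Since [c / x < (truncn (c / x)).+1], this index gives [c / n.+1 <= x]. *)
  exists (Num.truncn (c / x)) => //; rewrite /F/= in_itv/= xc andbT.
  rewrite ler_pdivrMr// -ler_pdivrMl// mulrC.
  by apply/ltW; rewrite truncnS_gt.
have ndF : {homo F : n m / (n <= m)%N >-> (n <= m)%O}.
  move=> n m nm; apply/subsetPset => x; rewrite /F/= !in_itv/= => /andP[+ ->].
  rewrite andbT; apply: le_trans; rewrite ler_pM2l// lef_pV2 ?posrE// ler_nat//.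
have cvF : (\int[mu]_(x in F i) (RL_kernel a x)%:E @[i --> \oo] -->
    \int[mu]_(x in \bigcup_i F i) (RL_kernel a x)%:E)%E.
  apply: ge0_nondecreasing_set_cvg_integral => // [i|i x _]; first exact: mk.
  by rewrite lee_fin RL_kernel_ge0.
rewrite FE in cvF.
apply: (@le_lt_trans _ _ (a^-1 * c `^ a)%:E); last by rewrite ltry.
apply: (cvge_le _ cvF); near=> n.
rewrite integral_RL_kernel_itv//.
- by rewrite lee_fin lerBlDr lerDl mulr_ge0// ?powR_ge0// invr_ge0 ltW.
- by rewrite divr_gt0.
- by rewrite ler_pdivrMr// ler_pMr// ler1n.
Unshelve. all: by end_near. Qed.

Lemma integrable_RL_kernel (a s u v : R) : 0 < a ->
  mu.-integrable `[u, v] (fun x => (RL_kernel a (s - x))%:E).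
Proof.
move=> a0.
(* For [x] in [[u, v]] one has [s - x <= s - u], so [c] bounds the reflected interval from above;
   the maximum with 1 keeps [c] positive when [s <= u]. *)
pose c := Num.max 1 (s - u).
have c0 : 0 < c by rewrite lt_max ltr01.
have mk := measurable_RL_kernel a.
have mks : measurable_fun setT (fun x : R => RL_kernel a (s - x)).
  apply: measurableT_comp => //; exact: measurable_funB.
apply/integrableP; split.
  by apply/measurable_EFinP; exact: measurable_funTS.
pose g := (fun x => (RL_kernel a x)%:E) \_ `]0, c].
have g0 x : (0 <= g x)%E by apply: erestrict_ge0 => y _; rewrite lee_fin RL_kernel_ge0.
have mg : measurable_fun setT g.
  by apply/(measurable_restrictT _ _).1 => //; apply: measurable_funTS; apply/measurable_EFinP.
apply: (@le_lt_trans _ _ (\int[mu]_x g (s - x)%R)%E); last first.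
  rewrite ge0_integral_reflect// /g.
  by rewrite -integral_mkcond integral_RL_kernel_lty.
rewrite integral_mkcond; apply: ge0_le_integral => //.
- by move=> x _; apply: erestrict_ge0.
- apply/(measurable_restrictT _ _).1 => //; apply: measurable_funTS.
  by apply: measurableT_comp => //; apply/measurable_EFinP.
- apply: measurableT_comp => //; exact: measurable_funB.
- move=> x _; rewrite patchE; case: ifPn => //.
  rewrite inE/= in_itv/= => /andP[ux xv].
  rewrite ger0_norm ?RL_kernel_ge0// /g patchE; case: ifPn => // /negP; rewrite inE/= in_itv/=.
  move=> /negP; rewrite negb_and /RL_kernel => /orP[/negbTE->//|].
  by rewrite le_max lerD2l lerN2 ux orbT.
Qed.

End kernel.

(** * Gamma function and Euler's beta integral *)

Section Gamma.
Context {R : realType}.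
Local Notation mu := (@lebesgue_measure R).
Implicit Types a x s t : R.

Let measurable_expRN : measurable_fun [set: R] (fun x => expR (- x)).
Proof. by apply: measurableT_comp => //; exact: measurable_expR. Qed.

Lemma measurable_RL_kernel_expRN a :
  measurable_fun [set: R] (fun x => RL_kernel a x * expR (- x)).
Proof. by apply: measurable_funM => //; exact: measurable_RL_kernel. Qed.

(** The integrand is dominated by the kernel on []0, 1]] and, since [x ^ (a - 1) <= 1] for [x > 1]
    and [a <= 1], by the exponential density beyond 1. *)
Lemma integral_RL_kernel_expRN_lty a : 0 < a -> a <= 1 ->
  (\int[mu]_x (RL_kernel a x * expR (- x))%:E < +oo)%E.
Proof.
move=> a0 a1.
have mk := measurable_RL_kernel a.
have mke := measurable_RL_kernel_expRN a.
have me : measurable_fun [set: R] (exponential_pdf (1 : R)).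
  exact: measurable_exponential_pdf.
have mk1 : measurable_fun [set: R] (RL_kernel a \_ `]0%R, 1%R]).
  by apply/(measurable_restrictT _ _).1 => //; exact: measurable_funTS.
have k0 x : 0 <= (RL_kernel a \_ `]0%R, 1%R]) x.
  by apply: restrict_ge0 => y _; exact: RL_kernel_ge0.
have e0 x : 0 <= exponential_pdf 1 x by exact: exponential_pdf_ge0.
apply: (@le_lt_trans _ _ (\int[mu]_x
    (((RL_kernel a \_ `]0%R, 1%R]) x)%:E + (exponential_pdf 1 x)%:E))%E).
  apply: ge0_le_integral => //.
  - by move=> x _; rewrite lee_fin mulr_ge0 ?RL_kernel_ge0 ?expR_ge0.
  - exact/measurable_EFinP.
  - by apply: emeasurable_funD; exact/measurable_EFinP.
  move=> x _; rewrite -EFinD lee_fin.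
  have [x0|x0] := leP x 0.
    by rewrite /RL_kernel ltNge x0/= mul0r addr_ge0.
  have [x1|x1] := leP x 1.
    rewrite patchE mem_set/=; last by rewrite in_itv/= x0.
    rewrite ler_wpDr// ler_piMr ?RL_kernel_ge0// -expR0 ler_expR oppr_le0 ltW//.
  rewrite ler_wpDl// exponential_pdfE ?(ltW x0)// mul1r mulN1r ler_piMl ?expR_ge0//.
  rewrite /RL_kernel x0 -[leRHS](powRr0 x) ler_powR ?subr_le0// ltW//.
rewrite ge0_integralD//=.
- rewrite integral_exponential_pdf//.
  rewrite (_ : \int[mu]_x ((RL_kernel a \_ `]0%R, 1%R]) x)%:E =
      \int[mu]_(x in `]0%R, 1%R]) (RL_kernel a x)%:E)%E; last first.
    rewrite [RHS]integral_mkcond; apply: eq_integral => x _.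
    by rewrite !patchE; case: ifP.
  by rewrite lte_add_pinfty ?ltry ?integral_RL_kernel_lty.
- by move=> x _; rewrite lee_fin.
- exact/measurable_EFinP.
- by move=> x _; rewrite lee_fin.
- exact/measurable_EFinP.
Qed.

(** [Gamma] is the [fine] part of an extended integral; finiteness makes it usable in Tonelli
    computations, and removing the null point 0 leaves the support of the kernel. *)
Lemma EFin_Gamma a : 0 < a -> a <= 1 ->
  (Gamma a)%:E = (\int[mu]_x (RL_kernel a x * expR (- x))%:E)%E.
Proof.
move=> a0 a1; have mke := measurable_RL_kernel_expRN a.
have ge0 : (0 <= \int[mu]_x (RL_kernel a x * expR (- x))%:E)%E.
  by apply: integral_ge0 => x _; rewrite lee_fin mulr_ge0 ?RL_kernel_ge0 ?expR_ge0.
rewrite -[RHS]fineK ?ge0_fin_numE ?integral_RL_kernel_expRN_lty//; congr EFin.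
rewrite /Gamma /Rintegral; congr fine.
rewrite -integral_itv_obnd_cbnd; last first.
  apply/measurable_EFinP; apply: measurable_funTS.
  by apply: measurable_funM; [exact: measurable_powR|exact: measurable_expRN].
rewrite integral_mkcond; apply: eq_integral => x _.
rewrite patchE mem_setE in_itv/= andbT /RL_kernel.
by case: ifP => // _; rewrite mul0r.
Qed.

(** On []0, 1]], an interval of length 1, the integrand is at least [expR (-1)], because
    [x ^ (a - 1) >= 1] there when [a <= 1]. *)
Lemma Gamma_gt0 a : 0 < a -> a <= 1 -> 0 < Gamma a.
Proof.
move=> a0 a1; have mke := measurable_RL_kernel_expRN a.
rewrite -lte_fin EFin_Gamma//.
apply: (@lt_le_trans _ _ (\int[mu]_(x in `]0%R, 1%R]) (expR (-1))%:E)%E).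
  rewrite integral_cst//= lebesgue_measure_itv/= lte01 oppr0 addr0 mule1.
  by rewrite lte_fin expR_gt0.
rewrite integral_mkcond; apply: ge0_le_integral => //.
- by move=> x _; apply: erestrict_ge0 => y _; rewrite lee_fin expR_ge0.
- by apply/(measurable_restrictT _ _).1 => //; exact: measurable_cst.
- exact/measurable_EFinP.
move=> x _; rewrite patchE; case: ifPn; last first.
  by move=> _; rewrite lee_fin mulr_ge0 ?RL_kernel_ge0 ?expR_ge0.
rewrite inE/= in_itv/= => /andP[x0 x1]; rewrite lee_fin /RL_kernel x0.
rewrite -[leLHS]mul1r ler_pM ?expR_ge0// ?ler_expR ?lerN2//.
rewrite -[leLHS](powRr0 x); apply: ger_powR; rewrite ?x0//.
by rewrite subr_le0.
Qed.

Lemma Gamma1 : Gamma (1 : R) = 1.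
Proof.
apply: EFin_inj; rewrite EFin_Gamma// -(@integral_exponential_pdf R 1)//.
apply: ae_eq_integral => //.
- apply/measurable_EFinP; exact: measurable_RL_kernel_expRN.
- apply/measurable_EFinP; exact: measurable_exponential_pdf.
(* At 0 the kernel of order 1 is 0 while the exponential density is 1. *)
exists [set 0]; split => //; first exact: lebesgue_measure_set1.
move=> x /=; apply: contra_notP => /eqP x0 _; congr EFin.
rewrite /RL_kernel; case: ltgtP x0 => // x0 _.
  by rewrite subrr powRr0 mul1r exponential_pdfE ?ltW// mul1r mulN1r.
by rewrite mul0r lt0_exponential_pdf.
Qed.

Lemma RL_kernelZ a s x : 0 < s -> RL_kernel a (s * x) = s `^ (a - 1) * RL_kernel a x.
Proof.
move=> s0; rewrite /RL_kernel pmulr_rgt0//; case: ifPn => x0; last by rewrite mulr0.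
by rewrite powRM// ltW.
Qed.

(** For [0 < s] the integrand is supported in []0, s[], so this is Euler's beta integral; the
    extended codomain postpones the question of finiteness. *)
Definition RL_convolution a b s : \bar R :=
  (\int[mu]_x (RL_kernel b (s - x) * RL_kernel a x)%:E)%E.

Let measurable_conv_integrand a b s :
  measurable_fun [set: R] (fun x => RL_kernel b (s - x) * RL_kernel a x).
Proof.
apply: measurable_funM; last exact: measurable_RL_kernel.
apply: measurableT_comp; [exact: measurable_RL_kernel | exact: measurable_funB].
Qed.

Lemma RL_convolution_le0 a b s : s <= 0 -> RL_convolution a b s = 0%E.
Proof.
move=> s0; rewrite /RL_convolution; apply: integral0_eq => x _; congr EFin.
rewrite /RL_kernel; case: ifPn => [xs|_]; last by rewrite mul0r.
by rewrite ifF ?mulr0//; apply/negbTE; rewrite -leNgt; lra.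
Qed.

(** Under [x |-> s * x] the two kernels are homogeneous of degrees [- a] and [a - 1]; the resulting
    factor [s^-1] is exactly the Jacobian factor. *)
Lemma RL_convolution_cst a s : 0 < s ->
  RL_convolution a (1 - a) s = RL_convolution a (1 - a) 1.
Proof.
move=> s0; have s1 : s^-1 != 0 by rewrite invr_eq0 gt_eqF.
have m1 u : measurable_fun setT (fun x => (RL_kernel (1 - a) (u - x) * RL_kernel a x)%:E).
  by apply/measurable_EFinP; exact: measurable_conv_integrand.
have g1 u x : (0 <= (RL_kernel (1 - a) (u - x) * RL_kernel a x)%:E)%E.
  by rewrite lee_fin mulr_ge0 ?RL_kernel_ge0.
apply/esym; apply: (mule_fin_inj _ _ _ _ s1); rewrite /RL_convolution.
transitivity (\int[mu]_x ((s^-1)%:E * (RL_kernel (1 - a) (1 - x) * RL_kernel a x)%:E))%E.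
  apply/esym/ge0_integralZl => //; first exact: m1.
  by rewrite lee_fin invr_ge0 ltW.
transitivity (\int[mu]_x (RL_kernel (1 - a) (s - s * x) *
    RL_kernel a (s * x))%:E)%E; last first.
  exact: (ge0_integral_scale _ _ s0 (m1 s) (g1 s)).
apply: eq_integral => x _; rewrite -EFinM; congr EFin.
rewrite -[X in X - _ * _]mulr1 -mulrBr !RL_kernelZ// mulrACA -powRD; last first.
  by rewrite (gt_eqF s0) implybT.
rewrite (_ : 1 - a - 1 + (a - 1) = -1); last by ring.
by rewrite powR_inv1// ltW.
Qed.

(* Integrate [RL_convolution a (1 - a) s * expR (- s)] over [s > 0], and exchange
   the integrals. *)
Lemma RL_convolutionE a s : 0 < a -> a < 1 -> 0 < s ->
  RL_convolution a (1 - a) s = (Gamma (1 - a) * Gamma a)%:E.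
Proof.
move=> a0 a1 s0.
have b0 : 0 < 1 - a by lra.
have b1 : 1 - a <= 1 by lra.
have mk b := measurable_RL_kernel b.
have mke b := measurable_RL_kernel_expRN b.
rewrite RL_convolution_cst// EFinM EFin_Gamma// EFin_Gamma ?(ltW a1)//.
set C := RL_convolution a (1 - a) 1.
set Gb := (\int[mu]_x (RL_kernel (1 - a) x * expR (- x))%:E)%E.
have C0 : (0 <= C)%E by apply: integral_ge0 => x _; rewrite lee_fin mulr_ge0 ?RL_kernel_ge0.
have Gb0 : (0 <= Gb)%E.
  by apply: integral_ge0 => x _; rewrite lee_fin mulr_ge0 ?RL_kernel_ge0 ?expR_ge0.
have shift x : Gb = (\int[mu]_y (RL_kernel (1 - a) (y - x) * expR (- (y - x)))%:E)%E.
  apply/esym/(ge0_integral_shift x (fun y => (RL_kernel (1 - a) y * expR (- y))%:E)).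
    exact/measurable_EFinP.
  by move=> y; rewrite lee_fin mulr_ge0 ?RL_kernel_ge0 ?expR_ge0.
transitivity (\int[mu]_x (Gb * (RL_kernel a x * expR (- x))%:E))%E; last first.
  apply: ge0_integralZl => //.
  - by apply/measurable_EFinP; exact: mke.
  - by move=> y _; rewrite lee_fin mulr_ge0 ?RL_kernel_ge0 ?expR_ge0.
have mshift x : measurable_fun setT
    (fun y : R => RL_kernel (1 - a) (y - x) * expR (- (y - x))).
  by apply: (measurableT_comp (mke (1 - a))); exact: measurable_funB.
(* Writing [expR (- y)] as [expR (- x) * expR (- (y - x))] makes each inner integral over [y] a
   translate of the Gamma integral [Gb]. *)
pose F (z : R * R) := ((RL_kernel a z.1 * expR (- z.1))%:E *
  (RL_kernel (1 - a) (z.2 - z.1) * expR (- (z.2 - z.1)))%:E)%E.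
have mF : measurable_fun setT F.
  apply/measurable_EFinP; apply: measurable_funM.
    by apply: (measurableT_comp (mke a)); exact: measurable_fst.
  apply: (measurableT_comp (mke (1 - a))); apply: measurable_funB.
    exact: measurable_snd.
  exact: measurable_fst.
have F0 z : (0 <= F z)%E.
  by rewrite /F -EFinM lee_fin !mulr_ge0 ?RL_kernel_ge0 ?expR_ge0.
transitivity (\int[mu]_x \int[mu]_y F (x, y))%E; last first.
  apply: eq_integral => x _; rewrite muleC (shift x) /F/=.
  apply: ge0_integralZl => //.
  - by apply/measurable_EFinP; exact: mshift.
  - by move=> y _; rewrite lee_fin mulr_ge0 ?RL_kernel_ge0 ?expR_ge0.
  - by rewrite lee_fin mulr_ge0 ?RL_kernel_ge0 ?expR_ge0.
transitivity (\int[mu]_y \int[mu]_x F (x, y))%E; last first.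
  by apply/esym; exact: fubini_tonelli.
(* The density has mass 1, so its product with the constant [C] integrates to [C]. It matches the
   inner integral except at 0, where the convolution vanishes and the density does not. *)
transitivity (\int[mu]_y (C * (exponential_pdf 1 y)%:E))%E.
  rewrite -[LHS]mule1 -(@integral_exponential_pdf R 1)//; apply/esym/ge0_integralZl => //.
  - by apply/measurable_EFinP; exact: measurable_exponential_pdf.
  - by move=> y _; rewrite lee_fin exponential_pdf_ge0.
apply: ae_eq_integral => //.
- apply: measurable_funeM.
  by apply/measurable_EFinP; exact: measurable_exponential_pdf.
- exact: measurable_fun_fubini_tonelli_G.
exists [set 0]; split => //; first exact: lebesgue_measure_set1.
move=> y /=; apply: contra_notP => /eqP y0 _.
have -> : (\int[mu]_x F (x, y) = (expR (- y))%:E * RL_convolution a (1 - a) y)%E.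
  transitivity (\int[mu]_x ((expR (- y))%:E *
      (RL_kernel (1 - a) (y - x) * RL_kernel a x)%:E))%E.
    apply: eq_integral => x _; rewrite /F/= -!EFinM mulrACA -expRD; congr EFin.
    by rewrite (_ : - x - (y - x) = - y); [ring|ring].
  apply: ge0_integralZl => //.
  - by apply/measurable_EFinP; exact: measurable_conv_integrand.
  - by move=> x _; rewrite lee_fin mulr_ge0 ?RL_kernel_ge0.
move: y0; rewrite neq_lt => /orP[y0|y0].
  by rewrite (RL_convolution_le0 _ _ _ (ltW y0)) (lt0_exponential_pdf _ y0) !mule0.
by rewrite (RL_convolution_cst _ _ y0) (exponential_pdfE _ (ltW y0)) mul1r mulN1r muleC.
Qed.

End Gamma.

(** * Semigroup law and Caputo derivative *)

Section semigroup.
Context {R : realType}.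
Local Notation mu := (@lebesgue_measure R).

Lemma RL_kernelE (a x : R) : a != 1 -> 0 <= x -> RL_kernel a x = x `^ (a - 1).
Proof.
move=> a1; rewrite le_eqVlt /RL_kernel => /predU1P[<-|->//].
by rewrite ltxx powR0// subr_eq0.
Qed.

Variables (a t0 t M : R) (psi : R -> R).
Hypotheses (a0 : 0 < a) (a1 : a < 1) (mpsi : measurable_fun `[t0, t] psi).
Hypothesis psiM : forall x, x \in `[t0, t] -> `|psi x| <= M.

Let b := 1 - a.
Let b0 : 0 < b. Proof. by rewrite subr_gt0. Qed.
Let b1 : b <= 1. Proof. by rewrite gerBl ltW. Qed.

Let psi0 := psi \_ `[t0, t].

Let mpsi0 : measurable_fun setT psi0.
Proof. by apply/(measurable_restrictT _ _).1. Qed.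

Let psi0M x : `|psi0 x| <= ((cst M) \_ `[t0, t]) x.
Proof.
rewrite /psi0 !patchE; case: ifPn => [|_]; last by rewrite normr0.
by rewrite mem_setE; exact: psiM.
Qed.

Let mK c s : measurable_fun setT (fun x : R => RL_kernel c (s - x)).
Proof.
by apply: measurableT_comp; [exact: measurable_RL_kernel|exact: measurable_funB].
Qed.

(** [z.1] is the variable of the outer fractional integral and [z.2] that of the inner one; the
    support [z.2 < z.1 < t] encodes the triangle of integration. *)
Let G (z : R * R) : R := RL_kernel b (t - z.1) * RL_kernel a (z.1 - z.2).
Let F (z : R * R) : \bar R := (G z * psi0 z.2)%:E.

Let mG : measurable_fun setT G.
Proof.
apply: measurable_funM.
  apply: (measurableT_comp (measurable_RL_kernel b)).
  by apply: measurable_funB => //; exact: measurable_fst.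
apply: (measurableT_comp (measurable_RL_kernel a)).
by apply: measurable_funB; [exact: measurable_fst|exact: measurable_snd].
Qed.

Let mF : measurable_fun setT F.
Proof.
apply/measurable_EFinP; apply: measurable_funM => //.
by apply: measurableT_comp => //; exact: measurable_snd.
Qed.

Let G0 z : 0 <= G z. Proof. by rewrite mulr_ge0 ?RL_kernel_ge0. Qed.

Let mG1 y : measurable_fun setT (fun x : R => (G (x, y))%:E).
Proof.
apply/measurable_EFinP; rewrite /G/=; apply: measurable_funM; first exact: mK.
by apply: (measurableT_comp (measurable_RL_kernel a)); exact: measurable_funB.
Qed.

Let B := Gamma b * Gamma a.

Let B0 : 0 <= B.
Proof. by rewrite mulr_ge0// ltW// Gamma_gt0// ltW. Qed.

(** Translation by [y] gives the convolution at [t - y], whose value is the same for all [y < t];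
    the constant [B] is what the two Gamma factors later cancel. *)
Let integralG y : (\int[mu]_x (G (x, y))%:E = (if y < t then B else 0)%:E)%E.
Proof.
transitivity (RL_convolution a b (t - y)).
  transitivity (\int[mu]_x (RL_kernel b (t - y - (x - y)) * RL_kernel a (x - y))%:E)%E.
    apply: eq_integral => x _; rewrite /G/=; congr (RL_kernel _ _ * _)%:E.
    by ring.
  apply: (ge0_integral_shift y (fun x => (RL_kernel b (t - y - x) * RL_kernel a x)%:E)).
    apply/measurable_EFinP; apply: measurable_funM; first exact: mK.
    exact: measurable_RL_kernel.
  by move=> x; rewrite lee_fin mulr_ge0 ?RL_kernel_ge0.
case: ltP => yt; last by rewrite RL_convolution_le0// subr_le0.
by rewrite RL_convolutionE// subr_gt0.
Qed.

Let integrableG y : mu.-integrable setT (fun x => (G (x, y))%:E).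
Proof.
apply/integrableP; split; first exact: mG1.
under eq_integral do rewrite abse_EFin ger0_norm//.
by rewrite integralG ltry.
Qed.

Let integral_absF y : (\int[mu]_x `|F (x, y)| = (`|psi0 y| * (if y < t then B else 0))%:E)%E.
Proof.
rewrite EFinM -integralG.
transitivity (\int[mu]_x (`|psi0 y|%:E * (G (x, y))%:E))%E.
  apply: eq_integral => x _; rewrite /F abse_EFin -EFinM normrM ger0_norm//.
  by rewrite mulrC.
by apply: ge0_integralZl => // [|x _]; [exact: mG1|rewrite lee_fin].
Qed.

(** Integrating [|F|] over the first variable leaves at most [M * B] on [[t0, t]] and 0
    elsewhere. *)
Let integrableF : (mu \x mu)%E.-integrable setT F.
Proof.
apply/integrable21ltyP; first exact: mF.
apply: (@le_lt_trans _ _ (\int[mu]_(y in `[t0, t]) (M * B)%:E)%E); last first.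
  rewrite integral_cst//= lebesgue_measure_itv/=; case: ifP => _.
    by rewrite -EFinB -EFinM ltry.
  by rewrite mule0 ltry.
rewrite [leRHS]integral_mkcond; apply: ge0_le_integral => //.
- by move=> y _; apply: integral_ge0.
- apply: (@measurable_fun_fubini_tonelli_G _ _ _ _ _ mu (fun z => `|F z|)%E) => //.
  exact: measurableT_comp.
- by apply/(measurable_restrictT _ _).1.
move=> y _; rewrite integral_absF; have := psi0M y; rewrite !patchE; case: ifPn => _ /= h.
  by rewrite lee_fin ler_pM//; case: ifP.
by rewrite (_ : `|psi0 y| = 0) ?mul0r//; apply/eqP; rewrite eq_le h normr_ge0.
Qed.

(** Integrability of [F] alone controls inner integrals for almost every [s]; domination by [M]
    times the kernel covers every [s], so that the inner integral is a real number. *)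
Let integrable_inner s : mu.-integrable setT (fun x => (RL_kernel a (s - x) * psi0 x)%:E).
Proof.
have h : mu.-integrable setT ((fun x => M%:E * (RL_kernel a (s - x))%:E)%E \_ `[t0, t]).
  apply/integrable_restrict => //; rewrite setTI; apply: integrableZl => //.
  exact: integrable_RL_kernel.
apply: le_integrable h => //.
  by apply/measurable_EFinP; apply: measurable_funM; [exact: mK|exact: mpsi0].
move=> x _; have := psi0M x; rewrite !patchE !abse_EFin normrM (ger0_norm (RL_kernel_ge0 _ _)).
case: ifP => _ /= h.
  rewrite lee_fin normrM (ger0_norm (RL_kernel_ge0 _ _)) mulrC.
  by rewrite ler_wpM2r ?RL_kernel_ge0// (le_trans h)// ler_norm.
rewrite (_ : `|psi0 x| = 0) ?mulr0 ?normr0//.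
by apply/eqP; rewrite eq_le h normr_ge0.
Qed.

Lemma bounded_RL_integral_comp :
  RL_integral (1 - a) t0 (RL_integral a t0 psi) t = \int[mu]_(x in `[t0, t]) psi x.
Proof.
have a1' : a != 1 by rewrite lt_eqF.
pose U s := \int[mu]_x (RL_kernel a (s - x) * psi0 x).
have UE s : (\int[mu]_x (RL_kernel a (s - x) * psi0 x)%:E = (U s)%:E)%E.
  by rewrite /U /Rintegral fineK//; exact: integrable_fin_num.
have RLU s : s \in `[t0, t] -> RL_integral a t0 psi s = (Gamma a)^-1 * U s.
  rewrite in_itv/= => /andP[t0s st]; rewrite /RL_integral gt_eqF//; congr (_ * _).
  rewrite /U [LHS]Rintegral_mkcond; apply: eq_Rintegral => x _.
  rewrite /psi0 !patchE !mem_setE !in_itv/=.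
  have [xs|xs] := leP x s.
    by rewrite andbT (le_trans xs st) andbT; case: ifP; rewrite ?mulr0// RL_kernelE ?subr_ge0.
  by rewrite andbF /RL_kernel subr_gt0 ltNge (ltW xs) mul0r.
have FE s : (\int[mu]_x F (s, x) = (RL_kernel b (t - s) * U s)%:E)%E.
  rewrite EFinM -UE -integralZl//; apply: eq_integral => x _.
  by rewrite /F /G/= -mulrA.
have iU : mu.-integrable setT (fun s => (RL_kernel b (t - s) * U s)%:E).
  rewrite (_ : (fun _ => _) = fubini_F mu F); last by apply/funext => s; rewrite -FE.
  exact: integrable_fubini_F.
have key : \int[mu]_s (RL_kernel b (t - s) * U s) = B * \int[mu]_(x in `[t0, t]) psi x.
  have ipsi : mu.-integrable `[t0, t] (EFin \o psi).
    apply: measurable_bounded_integrable => //.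
      by rewrite /= lebesgue_measure_itv/=; case: ifP; rewrite -?EFinB ltry.
    exists M; split => //; first exact: num_real.
    by move=> N MN x /psiM/le_trans; apply; exact: ltW.
  rewrite -RintegralZl// /Rintegral; congr fine.
  transitivity (\int[mu]_x \int[mu]_y F (x, y))%E; first by apply: eq_integral => s _; rewrite FE.
  transitivity (\int[mu]_y \int[mu]_x F (x, y))%E; first exact: Fubini.
  rewrite [RHS]integral_mkcond.
  apply: ae_eq_integral => //.
  - exact: (measurable_fubini_G integrableF).
  - apply/(measurable_restrictT _ _).1 => //; apply/measurable_EFinP; exact: measurable_funM.
  (* At [y = t] the integral of [G] is 0, whereas the restricted [psi] may be nonzero. *)
  exists [set t]; split => //; first exact: lebesgue_measure_set1.
  move=> y /=; apply: contra_notP => /eqP yt _.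
  transitivity ((psi0 y)%:E * \int[mu]_x (G (x, y))%:E)%E.
    rewrite -integralZl//; apply: eq_integral => x _.
    by rewrite /F -EFinM mulrC.
  rewrite integralG -EFinM /psi0 !patchE mem_setE in_itv/=.
  move: yt; rewrite neq_lt => /orP[yt|yt].
    by rewrite yt (ltW yt) andbT; case: ifP; rewrite ?mul0r// mulrC.
  by rewrite (lt_gtF yt) (leNgt y t) yt andbF mul0r.
rewrite {1}/RL_integral subr_eq0 gt_eqF//.
transitivity ((Gamma b)^-1 * ((Gamma a)^-1 * \int[mu]_s (RL_kernel b (t - s) * U s))).
  congr (_ * _); rewrite -RintegralZl// Rintegral_mkcond; apply: eq_Rintegral => s _.
  rewrite patchE mem_setE; case: ifPn => [ts|nts].
    have ts0 : 0 <= t - s by move: ts; rewrite in_itv/= subr_ge0 => /andP[].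
    have b1' : b != 1 by rewrite lt_eqF// /b gtrBl.
    by rewrite RLU// (RL_kernelE b _ b1' ts0) mulrCA.
  (* Outside [[t0, t]] the integrand vanishes: the outer kernel is 0 for [s > t], and [U s] is 0 for
     [s < t0], where the inner kernel misses the support of [psi0]. *)
  move: nts; rewrite in_itv/= negb_and -!ltNge => /orP[st0|ts]; last first.
    by rewrite {1}/RL_kernel subr_gt0 (lt_gtF ts) mul0r mulr0.
  rewrite (_ : U s = 0) ?mulr0// /U /Rintegral integral0_eq// => x _; congr EFin.
  rewrite /psi0 patchE mem_setE in_itv/=; case: ifPn; last by rewrite mulr0.
  by move=> /andP[t0x _]; rewrite /RL_kernel subr_gt0 ltNge (ltW (lt_le_trans st0 t0x)) mul0r.
rewrite key /B; field.
by rewrite !gt_eqF// Gamma_gt0// ltW.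
Qed.

End semigroup.

(** * Caputo derivatives and the reduction to continuous test functions *)

Section caputo.
Context {R : realType}.
Local Notation mu := (@lebesgue_measure R).

Lemma continuous_itv_measurable (u v : R) (g : R -> R) :
  {within `[u, v], continuous g} -> measurable_fun `[u, v] g.
Proof. by move=> cg; exact: subspace_continuous_measurable_fun. Qed.

Lemma continuous_itv_bounded (u v : R) (g : R -> R) :
  {within `[u, v], continuous g} ->
  exists M, forall x, x \in `[u, v] -> `|g x| <= M.
Proof.
move=> cg; have [vu|uv] := ltP v u.
  exists 0 => x; rewrite in_itv/= => /andP[ux xv].
  by have := lt_le_trans vu (le_trans ux xv); rewrite ltxx.
have cg' : {within `[u, v], continuous (fun x => `|g x|)}.
  by move=> x; apply: continuous_comp; [exact: cg|exact: norm_continuous].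
have [c _ cM] := EVT_max uv cg'.
by exists `|g c|.
Qed.

(** The case [a = 1] is separate: the integral of order 0 is the identity by definition, not a
    kernel integral. *)
Lemma continuous_RL_integral_comp (a t0 t : R) (psi : R -> R) : 0 < a -> a <= 1 ->
  {within `[t0, t], continuous psi} ->
  RL_integral (1 - a) t0 (RL_integral a t0 psi) t = \int[mu]_(x in `[t0, t]) psi x.
Proof.
move=> a0; rewrite le_eqVlt => /predU1P[-> _|a1 cpsi]; last first.
  have [M psiM] := continuous_itv_bounded _ _ _ cpsi.
  exact: (bounded_RL_integral_comp _ _ _ M _ a0 a1 (continuous_itv_measurable _ _ _ cpsi) psiM).
rewrite {1}/RL_integral subrr eqxx /RL_integral oner_eq0 Gamma1 invr1 mul1r.
by apply: eq_Rintegral => x _; rewrite subrr powRr0 mul1r.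
Qed.

Lemma within_id (T : Type) (F : set_system T) (FF : Filter F) (D : set T) :
  F D -> within D F = F.
Proof.
move=> FD; apply/predeqP => P; split; rewrite /within/=.
  by move=> FP; apply: filterS2 FD FP => x Dx; apply.
by move=> FP; apply: filterS FP.
Qed.

Lemma derivable_slope_cvg (P : R -> R) (t : R) : derivable P t 1 ->
  (P s - P t) / (s - t) @[s --> t^'] --> derive1 P t.
Proof.
rewrite /derivable => dP.
have dc : h^-1 *: (P (h + t) - P t) @[h --> (0:R)^'] --> derive1 P t.
  rewrite /derive1; set d := fun _ => _; set d' := (fun h => _) in dP.
  suff -> : d = d' by [].
  by apply/funext => h; rewrite /d /d' /= [h%:A]mulr1.
rewrite (_ : (fun s => _) =
    (fun h => h^-1 *: (P (h + t) - P t)) \o (fun s => s - t)); last first.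
  by apply/funext => s /=; rewrite subrK mulrC.
apply: cvg_comp dc.
move=> A [e e0 eA].
exists e => //= s /= se st; apply: eA => /=.
  by rewrite sub0r opprB.
by rewrite subr_eq0.
Qed.

(** Near an interior point, restricting to [[t0, t1]] does not change the filter, so the limit is
    the usual limit of slopes. *)
Lemma derivative_onE (t0 t1 t : R) (F P : R -> R) : t \in `]t0, t1[ ->
  {in `[t0, t1], F =1 P} -> derivable P t 1 -> derivative_on t0 t1 F t = derive1 P t.
Proof.
move=> tt FP dP; rewrite /derivative_on.
have nt : \forall s \near t^', s \in `[t0, t1].
  apply: nbhs_dnbhs; apply: filterS (near_in_itvoo tt) => s.
  exact: subset_itv_oo_cc.
rewrite (@within_id _ t^' _ `[t0, t1]%classic nt).
apply/cvg_lim; first exact: Rhausdorff.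
apply: cvg_trans (derivable_slope_cvg _ _ dP).
apply: near_eq_cvg; near=> s.
have ss : s \in `[t0, t1] by near: s.
by rewrite (FP _ ss) (FP t)//; exact: subset_itv_oo_cc.
Unshelve. all: by end_near. Qed.

Lemma caputoE (t0 t1 a : R) (h psi : R -> R) : 0 < a -> a <= 1 ->
  {within `[t0, t1], continuous psi} ->
  (forall t, t \in `[t0, t1] -> h t = h t0 + RL_integral a t0 psi t) ->
  {in `]t0, t1[, caputo t0 t1 a h =1 psi}.
Proof.
move=> a0 a1 cpsi hpsi t tt; rewrite /caputo.
have /andP[t0t tt1] : t0 < t < t1 by move: tt; rewrite in_itv.
have ipsi : mu.-integrable `[t0, t1] (EFin \o psi).
  by apply: continuous_compact_integrable => //; exact: segment_compact.
have [cpsi' _ _] := (continuous_within_itvP _ (lt_trans t0t tt1)).1 cpsi.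
have [dP PE] := continuous_FTC1_closed tt1 ipsi t0t (cpsi' _ tt).
rewrite -PE; apply: derivative_onE => // s; rewrite in_itv/= => /andP[t0s st1].
rewrite -(continuous_RL_integral_comp a)//; last first.
  by apply: continuous_subspaceW cpsi; exact: subset_itvl.
have E x : x \in `[t0, s] -> h x - h t0 = RL_integral a t0 psi x.
  rewrite in_itv/= => /andP[t0x xs]; rewrite hpsi ?in_itv/= ?t0x ?(le_trans xs)//.
  by rewrite addrAC subrr add0r.
rewrite {1 2}/RL_integral; case: ifPn => _; first by rewrite E// in_itv/= t0s lexx.
congr (_ * _); apply: eq_Rintegral => x; rewrite mem_setE => xs.
by rewrite E.
Qed.

(** If [h] is the fractional integral of [psi], then [h t0 = 0] holds automatically, and [h t1 = 0]
    is the orthogonality of [psi] to [(t1 - t) ^ (a - 1)], up to the factor [(Gamma a)^-1]. *)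
Lemma variational_conditionP (t0 t1 a b : R) (f : R -> R) :
  t0 < t1 -> 0 < a -> a <= 1 -> {within `[t0, t1], continuous f} ->
  variational_condition t0 t1 a b f <->
  forall psi, {within `[t0, t1], continuous psi} ->
    \int[mu]_(t in `[t0, t1]) ((t1 - t) `^ (a - 1) * psi t) = 0 ->
    \int[mu]_(t in `[t0, t1]) ((t1 - t) `^ (b - 1) * f t * psi t) = 0.
Proof.
move=> t01 a0 a1 cf.
have caputo_int h psi : {within `[t0, t1], continuous psi} ->
    (forall t, t \in `[t0, t1] -> h t = h t0 + RL_integral a t0 psi t) ->
    \int[mu]_(t in `[t0, t1]) ((t1 - t) `^ (b - 1) * f t * caputo t0 t1 a h t) =
    \int[mu]_(t in `[t0, t1]) ((t1 - t) `^ (b - 1) * f t * psi t).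
  move=> cpsi hpsi; have E := caputoE _ _ _ _ _ a0 a1 cpsi hpsi.
  have E' : {in `]t0, t1[, (fun t => (t1 - t) `^ (b - 1) * f t * caputo t0 t1 a h t) =1
     (fun t => (t1 - t) `^ (b - 1) * f t * psi t)} by move=> t tt; rewrite E.
  have sub : `]t0, t1[ `<=` `[t0, t1] by exact: subset_itv_oo_cc.
  have m : measurable_fun `]t0, t1[ (fun t => (t1 - t) `^ (b - 1) * f t * psi t).
    apply: measurable_funM; last first.
      by apply: measurable_funS (continuous_itv_measurable _ _ _ cpsi).
    apply: measurable_funM; last first.
      by apply: measurable_funS (continuous_itv_measurable _ _ _ cf).
    apply: measurable_funTS; apply: (measurableT_comp (measurable_powR _)).
    exact: measurable_funB.
  rewrite /Rintegral; congr fine; apply: eq_integral_itv_bounded => //.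
  apply: eq_measurable_fun m => t; rewrite mem_setE => tt; by rewrite E'.
have RL1 psi : RL_integral a t0 psi t1 =
    (Gamma a)^-1 * \int[mu]_(t in `[t0, t1]) ((t1 - t) `^ (a - 1) * psi t).
  by rewrite /RL_integral gt_eqF.
split=> [vc psi cpsi psi0|vc h [[psi [cpsi hpsi]] h0 h1]].
- pose h := RL_integral a t0 psi.
  have h0 : h t0 = 0.
    by rewrite /h /RL_integral gt_eqF// set_itv1 Rintegral_set1 mulr0.
  have hpsi t : t \in `[t0, t1] -> h t = h t0 + RL_integral a t0 psi t.
    by move=> _; rewrite h0 add0r.
  rewrite -(caputo_int h psi cpsi hpsi); apply: vc; split; [by exists psi|exact: h0|].
  by rewrite /h RL1 psi0 mulr0.
- rewrite (caputo_int h psi)//; apply: vc => //.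
  have : h t1 = 0 by [].
  rewrite hpsi ?in_itv/= ?lexx ?(ltW t01)// h0 add0r RL1 => /eqP.
  by rewrite mulf_eq0 invr_eq0 gt_eqF ?Gamma_gt0//= => /eqP.
Qed.

End caputo.

(** * The lemma of du Bois-Reymond with a power weight *)

Section integral_continuous.
Context {R : realType}.
Local Notation mu := (@lebesgue_measure R).
Variables (u v : R).
Hypothesis uv : u < v.

Lemma continuous_itv_integrable (g : R -> R) : {within `[u, v], continuous g} ->
  mu.-integrable `[u, v] (EFin \o g).
Proof. by move=> cg; apply: continuous_compact_integrable => //; exact: segment_compact. Qed.

Lemma continuous_itv_eq (g h : R -> R) : {within `[u, v], continuous g} ->
  {within `[u, v], continuous h} -> {in `]u, v[, g =1 h} -> {in `[u, v], g =1 h}.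
Proof.
move=> /(continuous_within_itvP _ uv)[_ gu gv] /(continuous_within_itvP _ uv)[_ hu hv] gh x.
rewrite in_itv/= => /andP[].
rewrite le_eqVlt => /predU1P[<- _|ux].
  have gu' : g x @[x --> u^'+] --> h u.
    apply: cvg_trans hu; apply: near_eq_cvg; near=> y.
    by rewrite gh// in_itv/=; apply/andP; split; near: y;
      [exact: nbhs_right_gt|exact: nbhs_right_lt].
  exact: (cvg_unique _ gu gu').
rewrite le_eqVlt => /predU1P[->|xv]; last by apply: gh; rewrite in_itv/= ux.
have gv' : g x @[x --> v^'-] --> h v.
  apply: cvg_trans hv; apply: near_eq_cvg; near=> y.
  by rewrite gh// in_itv/=; apply/andP; split; near: y;
    [exact: nbhs_left_gt|exact: nbhs_left_lt].
exact: (cvg_unique _ gv gv').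
Unshelve. all: by end_near. Qed.

(** The primitive of [g] is squeezed between 0 and the total integral 0, hence is constant, and its
    derivative is [g]. *)
Lemma continuous_ge0_Rintegral_eq0 (g : R -> R) : {within `[u, v], continuous g} ->
  (forall x, x \in `[u, v] -> 0 <= g x) -> \int[mu]_(x in `[u, v]) g x = 0 ->
  {in `]u, v[, g =1 cst 0}.
Proof.
move=> cg g0 ig.
have intg := continuous_itv_integrable _ cg.
pose P x := \int[mu]_(t in `[u, x]) g t.
have P0 x : x \in `]u, v[ -> P x = 0.
  rewrite in_itv/= => /andP[ux xv]; apply/eqP; rewrite eq_le; apply/andP; split.
    have ux' : (BLeft u <= BRight x)%O by rewrite bnd_simp ltW.
    have xv' : (BRight x <= BRight v)%O by rewrite bnd_simp ltW.
    rewrite -oppr_ge0 -sub0r -[X in X - _]ig (Rintegral_itvB intg ux' xv').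
    apply: Rintegral_ge0 => t.
    rewrite /= in_itv/= => /andP[xt tv]; apply: g0.
    by rewrite in_itv/= tv (ltW (lt_trans ux xt)).
  apply: Rintegral_ge0 => t; rewrite /= in_itv/= => /andP[ut tx]; apply: g0.
  by rewrite in_itv/= ut (le_trans tx (ltW xv)).
have [cg' _ _] := (continuous_within_itvP _ uv).1 cg.
move=> x xuv; have /andP[ux xv] : u < x < v by move: xuv; rewrite in_itv.
have [_ PE] := continuous_FTC1_closed xv intg ux (cg' _ xuv).
rewrite -PE derive1E (@near_eq_derive _ _ _ _ (cst 0)) ?derive_cst//.
near=> y; apply: P0; near: y; exact: near_in_itvoo.
Unshelve. all: by end_near. Qed.

Lemma eq_Rintegral_oo (g h : R -> R) : measurable_fun `]u, v[ g -> measurable_fun `]u, v[ h ->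
  {in `]u, v[, g =1 h} -> \int[mu]_(x in `[u, v]) g x = \int[mu]_(x in `[u, v]) h x.
Proof. by move=> mg mh gh; congr fine; exact: eq_integral_itv_bounded. Qed.

End integral_continuous.

(** * Powers of the distance to the right endpoint *)

Section weight.
Context {R : realType}.
Local Notation mu := (@lebesgue_measure R).
Variables (t0 t1 : R).
Hypothesis t01 : t0 < t1.

Lemma continuous_powRB (p : R) : 0 <= p ->
  {within `[t0, t1], continuous (fun t => (t1 - t) `^ p)}.
Proof.
rewrite le_eqVlt => /predU1P[<-|p0].
  rewrite (_ : (fun t => _) = cst 1); last by apply/funext => t; rewrite powRr0.
  by move=> x; exact: cst_continuous.
have c x : x < t1 -> {for x, continuous (fun t => (t1 - t) `^ p)}.
  move=> xt1; apply: (@continuous_comp _ _ _ (fun t => t1 - t) (fun y => y `^ p)).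
    by apply: continuousB; [exact: cst_continuous|exact: cvg_id].
  apply: differentiable_continuous; apply/derivable1_diffP.
  have tx : 0 < t1 - x by rewrite subr_gt0.
  by have [] := is_derive1_powR p tx.
apply/continuous_within_itvP => //; split.
- by move=> x; rewrite in_itv/= => /andP[_ xt]; exact: c.
- by apply: cvg_at_right_filter; exact: c.
- rewrite subrr powR0 ?gt_eqF//.
  apply: (@cvg_comp _ _ _ (fun t => t1 - t) (fun y => y `^ p)); last exact: powR_cvg0 p0.
  move=> A [e e0 eA]; exists e => //= s /= se st; apply: eA => /=.
    by rewrite sub0r normrN.
  by rewrite subr_gt0.
Qed.

Lemma measurable_powRB (p : R) D : measurable_fun D (fun t : R => (t1 - t) `^ p).
Proof.
apply: measurable_funTS; apply: (measurableT_comp (measurable_powR _)).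
exact: measurable_funB.
Qed.

Lemma within_continuousM (g h : R -> R) : {within `[t0, t1], continuous g} ->
  {within `[t0, t1], continuous h} -> {within `[t0, t1], continuous (fun t => g t * h t)}.
Proof. by move=> cg ch x; apply: continuousM; [exact: cg|exact: ch]. Qed.

Lemma within_continuousB (g h : R -> R) : {within `[t0, t1], continuous g} ->
  {within `[t0, t1], continuous h} -> {within `[t0, t1], continuous (fun t => g t - h t)}.
Proof. by move=> cg ch x; apply: continuousB; [exact: cg|exact: ch]. Qed.

End weight.

Section du_bois_reymond.
Context {R : realType}.
Local Notation mu := (@lebesgue_measure R).
Variables (t0 t1 a b : R) (f : R -> R).
Hypotheses (t01 : t0 < t1) (a0 : 0 < a) (a1 : a <= 1) (b0 : 0 < b).
Hypothesis cf : {within `[t0, t1], continuous f}.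

Let W p t := (t1 - t) `^ p.

(** At [t1] the rule fails: for [q = - p] with [p] nonzero, the left side would be 0 and the right
    side [0 ^ 0 = 1]. *)
Let WD p q t : t < t1 -> W p t * W q t = W (p + q) t.
Proof.
move=> tt; have h : t1 - t != 0 by rewrite gt_eqF// subr_gt0.
by rewrite /W powRD// h implybT.
Qed.

Let W_gt0 p t : t < t1 -> 0 < W p t.
Proof. by move=> tt; rewrite powR_gt0// subr_gt0. Qed.

Let itv_lt t : t \in `]t0, t1[ -> t < t1.
Proof. by rewrite in_itv/= => /andP[]. Qed.

Let mW p D : measurable_fun D (W p).
Proof. exact: measurable_powRB. Qed.

Let cW (p : R) : 0 <= p -> {within `[t0, t1], continuous W p}.
Proof. exact: continuous_powRB. Qed.

Let ccst c : {within `[t0, t1], continuous (fun=> c : R)}.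
Proof. by move=> x; exact: cst_continuous. Qed.

Let moo (g : R -> R) : {within `[t0, t1], continuous g} -> measurable_fun `]t0, t1[ g.
Proof.
move=> /continuous_itv_measurable; apply: measurable_funS => //.
exact: subset_itv_oo_cc.
Qed.

Lemma du_bois_reymond_powR :
  (forall psi, {within `[t0, t1], continuous psi} ->
    \int[mu]_(t in `[t0, t1]) ((t1 - t) `^ (a - 1) * psi t) = 0 ->
    \int[mu]_(t in `[t0, t1]) ((t1 - t) `^ (b - 1) * f t * psi t) = 0) ->
  exists k, {in `]t0, t1[, forall t, (t1 - t) `^ (b - a) * f t = k}.
Proof.
move=> vc; have := (a0, a1, b0, t01) => -[[[a0' a1'] b0'] t01'].
pose A := \int[mu]_(t in `[t0, t1]) (W (1 + b) t * f t).
pose C := \int[mu]_(t in `[t0, t1]) W (1 + a) t.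
have cA : {within `[t0, t1], continuous (fun t => W (1 + b) t * f t)}.
  by apply: within_continuousM => //; apply: cW; lra.
have cC : {within `[t0, t1], continuous W (1 + a)} by apply: cW; lra.
have iA := continuous_itv_integrable _ _ _ cA.
have iC := continuous_itv_integrable _ _ _ cC.
have C0 : C != 0.
  apply/negP => /eqP /(continuous_ge0_Rintegral_eq0 _ _ t01 _ cC) C0.
  have mid : (t0 + t1) / 2 \in `]t0, t1[ by rewrite in_itv/=; apply/andP; split; lra.
  have := W_gt0 (1 + a) _ (itv_lt _ mid); rewrite C0 ?ltxx// => x _; exact: powR_ge0.
pose k := A / C; exists k.
(* With [g := W (b - a) * f], this is [W 2 * (g - k)], where the factor [W 2] makes it
   continuous; [k] is chosen so that the constraint holds, and then the integral of
   [W (1 + a) * (g - k) ^+ 2] vanishes. *)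
pose psi t := W (2 + b - a) t * f t - k * W 2 t.
have cpsi : {within `[t0, t1], continuous psi}.
  apply: within_continuousB; first by apply: within_continuousM => //; apply: cW; lra.
  by apply: within_continuousM => //; apply: cW; lra.
(* On the open interval this is [W (a - 1) * psi] with exponents added up; the form chosen here is
   continuous up to [t1]. *)
pose H2 t := W (1 + b) t * f t - k * W (1 + a) t.
have cH2 : {within `[t0, t1], continuous H2}.
  by apply: within_continuousB => //; apply: within_continuousM.
have H20 : \int[mu]_(t in `[t0, t1]) H2 t = 0.
  rewrite RintegralB//; last first.
    by apply: continuous_itv_integrable; apply: within_continuousM.
  by rewrite RintegralZl// -/A -/C /k divfK// subrr.
have psi0 : \int[mu]_(t in `[t0, t1]) ((t1 - t) `^ (a - 1) * psi t) = 0.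
  rewrite -[RHS]H20; apply: eq_Rintegral_oo.
  - by apply: measurable_funM; [exact: mW|exact: moo].
  - exact: moo.
  move=> t /itv_lt tt; rewrite /psi /H2 -/(W (a - 1) t).
  rewrite (_ : 1 + b = a - 1 + (2 + b - a)); last by ring.
  rewrite (_ : 1 + a = a - 1 + 2); last by ring.
  by rewrite -(WD (a - 1) (2 + b - a) _ tt) -(WD (a - 1) 2 _ tt); ring.
have := vc _ cpsi psi0.
(* Likewise for [W (b - 1) * f * psi]. The exponent [1 + 2 * b - a] is positive as [a <= 1] and
   [0 < b]; a factor [W 1] in [psi] would give [2 * b - a], possibly negative. *)
pose H1 t := W (1 + 2 * b - a) t * (f t * f t) - k * (W (1 + b) t * f t).
have cH1 : {within `[t0, t1], continuous H1}.
  apply: within_continuousB; apply: within_continuousM => //; last exact: within_continuousM.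
  by apply: cW; lra.
have -> : \int[mu]_(t in `[t0, t1]) ((t1 - t) `^ (b - 1) * f t * psi t) =
          \int[mu]_(t in `[t0, t1]) H1 t.
  apply: eq_Rintegral_oo.
  - apply: measurable_funM; last exact: moo.
    by apply: measurable_funM; [exact: mW|exact: moo].
  - exact: moo.
  move=> t /itv_lt tt; rewrite /psi /H1 -/(W (b - 1) t).
  rewrite (_ : 1 + 2 * b - a = b - 1 + (2 + b - a)); last by ring.
  rewrite (_ : 1 + b = b - 1 + 2); last by ring.
  by rewrite -(WD (b - 1) (2 + b - a) _ tt) -(WD (b - 1) 2 _ tt); ring.
move=> H10.
(* Subtracting [k] times the constraint, whose integral is 0, completes the square. *)
pose G t := H1 t - k * H2 t.
have cG : {within `[t0, t1], continuous G}.
  by apply: within_continuousB => //; apply: within_continuousM.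
have GE t : t < t1 -> G t = W (1 + a) t * (W (b - a) t * f t - k) ^+ 2.
  move=> tt; rewrite /G /H1 /H2.
  rewrite (_ : 1 + 2 * b - a = (1 + a) + (b - a) + (b - a)); last by ring.
  rewrite (_ : 1 + b = (1 + a) + (b - a)); last by ring.
  rewrite -(WD (1 + a + (b - a)) (b - a) _ tt) -(WD (1 + a) (b - a) _ tt).
  by ring.
have G0 : {in `]t0, t1[, G =1 cst 0}.
  apply: continuous_ge0_Rintegral_eq0 => //.
    move=> t; rewrite in_itv/= => /andP[_]; rewrite le_eqVlt => /predU1P[->|tt].
      have W0 p : 0 < p -> W p t1 = 0 by move=> p0; rewrite /W subrr powR0// gt_eqF.
      by rewrite /G /H1 /H2 !W0; lra.
    by rewrite GE// mulr_ge0 ?sqr_ge0// ltW// W_gt0.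
  rewrite /G RintegralB//.
  - rewrite H10 RintegralZl//; last exact: continuous_itv_integrable.
    by rewrite H20 mulr0 subrr.
  - exact: continuous_itv_integrable.
  - by apply: continuous_itv_integrable; apply: within_continuousM.
move=> t tt; have := GE t (itv_lt _ tt); rewrite G0// => /esym/eqP.
by rewrite mulf_eq0 gt_eqF ?W_gt0 ?itv_lt//= sqrf_eq0 subr_eq0 => /eqP.
Qed.

(** Extracting the constant requires integrability of a weight that is singular at [t1] for [a < 1];
    off the endpoints the weight is the kernel, already known to be integrable. *)
Lemma Rintegral_powRB_Ml (c : R) (psi : R -> R) : {within `[t0, t1], continuous psi} ->
  \int[mu]_(t in `[t0, t1]) (c * ((t1 - t) `^ (a - 1) * psi t)) =
  c * \int[mu]_(t in `[t0, t1]) ((t1 - t) `^ (a - 1) * psi t).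
Proof.
move=> cpsi; have [M psiM] := continuous_itv_bounded _ _ _ cpsi.
have mK : measurable_fun `[t0, t1] (fun t : R => RL_kernel a (t1 - t)).
  apply: measurable_funTS; apply: (measurableT_comp (measurable_RL_kernel _)).
  exact: measurable_funB.
have iK : mu.-integrable `[t0, t1] (EFin \o (fun t => RL_kernel a (t1 - t) * psi t)).
  have h : mu.-integrable `[t0, t1] (fun x => M%:E * (RL_kernel a (t1 - x))%:E)%E.
    by apply: integrableZl => //; exact: integrable_RL_kernel.
  apply: le_integrable h => //.
    apply/measurable_EFinP; apply: measurable_funM => //.
    exact: continuous_itv_measurable.
  move=> x /psiM xM; rewrite /= lee_fin !normrM !(ger0_norm (RL_kernel_ge0 _ _)) mulrC.
  by rewrite ler_wpM2r ?RL_kernel_ge0// (le_trans xM)// ler_norm.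
have mWpsi : measurable_fun `]t0, t1[ (fun t => (t1 - t) `^ (a - 1) * psi t).
  by apply: measurable_funM; [exact: mW|exact: moo].
have mKpsi : measurable_fun `]t0, t1[ (fun t => RL_kernel a (t1 - t) * psi t).
  apply: measurable_funM; last exact: moo.
  by apply: measurable_funS mK => //; exact: subset_itv_oo_cc.
have E : {in `]t0, t1[, (fun t => (t1 - t) `^ (a - 1) * psi t) =1
                        (fun t => RL_kernel a (t1 - t) * psi t)}.
  by move=> t; rewrite in_itv/= /RL_kernel subr_gt0 => /andP[_ ->].
rewrite (eq_Rintegral_oo _ _ _ _ mWpsi mKpsi E) -RintegralZl//.
apply: eq_Rintegral_oo; [exact: measurable_funM|exact: measurable_funM|].
by move=> t tt; rewrite (E t tt).
Qed.

End du_bois_reymond.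

(** For [beta <= alpha] the constant given by the du Bois-Reymond argument may be 0, and [f = 0]
    does satisfy the variational condition; hence the alternative beside [k <> 0]. *)
Theorem lemma3p1 (R : realType) (t0 t1 : R) (f : R -> R) (alpha beta : R)
    (ht : t0 < t1) (hf : {within `[t0, t1], continuous f})
    (halpha0 : 0 < alpha) (halpha1 : alpha <= 1) (hbeta : 0 < beta) :
  (alpha < beta ->
    (variational_condition t0 t1 alpha beta f <->
     forall t, t \in `[t0, t1] -> (t1 - t) `^ (beta - alpha) * f t = 0)) /\
  (beta <= alpha ->
    (variational_condition t0 t1 alpha beta f <->
     (forall t, t \in `[t0, t1] -> f t = 0) \/
     exists k : R, k <> 0 /\
       forall t, t \in `[t0, t1] ->
         f t = k / Gamma alpha * (t1 - t) `^ (alpha - beta))).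
Proof.
have vcP := variational_conditionP _ _ alpha beta _ ht halpha0 halpha1 hf.
have dbr := du_bois_reymond_powR _ _ alpha beta _ ht halpha0 halpha1 hbeta hf.
have sub : `]t0, t1[ `<=` `[t0, t1] by exact: subset_itv_oo_cc.
have mWpsi psi : {within `[t0, t1], continuous psi} ->
    measurable_fun `]t0, t1[ (fun t => (t1 - t) `^ (beta - 1) * f t * psi t).
  move=> cpsi; apply: measurable_funM; last first.
    exact: measurable_funS (continuous_itv_measurable _ _ _ cpsi).
  apply: measurable_funM; first exact: measurable_powRB.
  exact: measurable_funS (continuous_itv_measurable _ _ _ hf).
have f0vc : {in `]t0, t1[, forall t, f t = 0} -> variational_condition t0 t1 alpha beta f.
  move=> f0; apply/vcP => psi cpsi _.
  rewrite (eq_Rintegral_oo _ _ _ (cst 0) (mWpsi _ cpsi)) ?Rintegral_cst ?mul0r//.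
  by move=> t tt; rewrite f0// mulr0 mul0r.
have tt1 t : t \in `]t0, t1[ -> t1 - t != 0.
  by rewrite in_itv/= => /andP[_ tt]; rewrite gt_eqF// subr_gt0.
have G0 := Gamma_gt0 alpha halpha0 halpha1.
split=> [ab|ba]; split.
- move=> /vcP/dbr[k gk].
  have cg : {within `[t0, t1], continuous (fun t => (t1 - t) `^ (beta - alpha) * f t)}.
    by apply: within_continuousM => //; apply: continuous_powRB => //; rewrite subr_ge0 ltW.
  have ck : {within `[t0, t1], continuous (fun=> k)} by move=> x; exact: cst_continuous.
  have E := continuous_itv_eq _ _ ht _ _ cg ck gk.
  (* Evaluation at [t1], where the power with positive exponent [beta - alpha] vanishes. *)
  have k0 : k = 0.
    rewrite -(E t1) ?in_itv/= ?lexx ?ltW//.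
    by rewrite subrr powR0 ?mul0r// subr_eq0 gt_eqF.
  by move=> t tt; rewrite E.
- move=> g0; apply: f0vc => t tt; have /eqP := g0 t (sub _ tt).
  by rewrite mulf_eq0 powR_eq0 (negbTE (tt1 _ tt))/= => /eqP.
- move=> /vcP/dbr[k gk].
  (* Solving for [f] yields the exponent [alpha - beta >= 0], so both sides are continuous on the
     closed interval and equality extends to the endpoints. *)
  have ck : {within `[t0, t1], continuous (fun t => k * (t1 - t) `^ (alpha - beta))}.
    apply: within_continuousM; first by move=> x; exact: cst_continuous.
    by apply: continuous_powRB => //; rewrite subr_ge0.
  have E : {in `[t0, t1], f =1 (fun t => k * (t1 - t) `^ (alpha - beta))}.
    apply: continuous_itv_eq => // t tt; rewrite -(gk t tt) mulrAC -powRD; last first.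
      by rewrite tt1 ?implybT.
    by rewrite (_ : beta - alpha + (alpha - beta) = 0) ?powRr0 ?mul1r//; ring.
  have [k0|k0] := eqVneq k 0; [left|right].
    by move=> t tt; rewrite E// k0 mul0r.
  exists (k * Gamma alpha); split.
    by apply/eqP; rewrite mulf_neq0// gt_eqF.
  by move=> t tt; rewrite mulfK ?gt_eqF// E.
- case=> [f0|[k [_ fk]]]; first by apply: f0vc => t /sub; exact: f0.
  apply/vcP => psi cpsi psi0.
  (* With this [f], the integrand is a constant multiple of that of the constraint on the open
     interval. *)
  rewrite (eq_Rintegral_oo _ _ _
    (fun t => k / Gamma alpha * ((t1 - t) `^ (alpha - 1) * psi t)) (mWpsi _ cpsi)).
  + by rewrite Rintegral_powRB_Ml// psi0 mulr0.
  + apply: measurable_funM => //; apply: measurable_funM; first exact: measurable_powRB.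
    exact: measurable_funS (continuous_itv_measurable _ _ _ cpsi).
  + move=> t tt; rewrite fk; last exact: sub.
    rewrite (_ : alpha - 1 = beta - 1 + (alpha - beta)); last by ring.
    by rewrite (@powRD _ _ (beta - 1) (alpha - beta)) ?tt1 ?implybT//; ring.
Qed.
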